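(* Let $s\ge 1$ be an integer and let $L$ be a finite-dimensional Leibniz algebra over a field $F$ with $|F|>s$. Then $L$ has precisely $s$ maximal subalgebras if and only if $L$ is cyclic with $s$ distinct associated irreducible factors.
   Context: A (right) Leibniz algebra over a field $F$ is an $F$-vector space $L$ with a bilinear product $[\cdot,\cdot]$ satisfying $[x,[y,z]]=[[x,y],z]-[[x,z],y]$ for all $x,y,z\in L$. Powers of an element are defined by $x^1=x$, $x^{k+1}=[x^k,x]$. $L$ is called cyclic if it is generated, as a Leibniz algebra, by a single element $a$. In this case $L$ has a basis $a,a^2,\ldots,a^n$, with $[a^n,a]=\alpha_2a^2+\cdots+\alpha_na^n$ for some $\alpha_i\in F$. Put $p(x)=x^n-\alpha_nx^{n-1}-\cdots-\alpha_2x$ (the polynomial whose companion matrix is the matrix of the right multiplication $R_a:y\mapsto[y,a]$ in this basis), and factor $p(x)=p_1(x)^{n_1}\cdots p_s(x)^{n_s}$ with $p_1,\ldots,p_s$ the distinct (monic) irreducible factors of $p(x)$ over $F$. These $p_j$ are called the distinct irreducible factors associated with $L$. For a one-dimensional algebra $L=Fa$ with $a^2=0$ one has $p(x)=x$. A maximal subalgebra is a proper subalgebra not properly contained in another proper subalgebra. *)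

(* Defs.v *)
From mathcomp Require Import all_boot all_order all_algebra.

Set Implicit Arguments.
Unset Strict Implicit.
Unset Printing Implicit Defensive.

Import GRing.Theory.
Local Open Scope ring_scope.

Section Leibniz.

Variables (F : fieldType) (L : vectType F) (br : {bilinear L -> L -> L}).

Definition right_leibniz : Prop :=
  forall x y z : L, br x (br y z) = br (br x y) z - br (br x z) y.

Definition subalgebra (S : {vspace L}) : Prop :=
  forall x y : L, x \in S -> y \in S -> br x y \in S.

Definition proper_subalgebra (S : {vspace L}) : Prop :=
  subalgebra S /\ S <> fullv.

Definition maximal_subalgebra (M : {vspace L}) : Prop :=
  proper_subalgebra M /\
  forall S : {vspace L}, proper_subalgebra S -> (M <= S)%VS -> S = M.

Definition generates (a : L) : Prop :=
  forall S : {vspace L}, subalgebra S -> a \in S -> S = fullv.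

(* lpow a k is a^k for k >= 1, with the convention a^(k+1) = [a^k, a];
   the value lpow a 0 = a is never used when L is nonzero. *)
Definition lpow (a : L) (k : nat) : L := iter k.-1 (fun y => br y a) a.

Definition lpow_tuple (a : L) : (\dim {:L}).-tuple L :=
  [tuple lpow a i.+1 | i < \dim {:L}].

(* With n = \dim L, the index i < n stands for a^(i+1), so the coordinate at i
   is alpha_(i+1) and it is the coefficient of -x^i. The range 0 < i reflects
   [a^n, a] = alpha_2 a^2 + ... + alpha_n a^n: when a generates L, lpow_tuple a
   is a basis of L and the coordinate along a vanishes. *)
Definition assoc_poly (a : L) : {poly F} :=
  'X^(\dim {:L}) -
  \sum_(i < \dim {:L} | (0 < i)%N)
     coord (lpow_tuple a) i (br (lpow a (\dim {:L})) a) *: 'X^i.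

End Leibniz.

Definition has_distinct_irreducible_factors (F : fieldType)
    (p : {poly F}) (s : nat) : Prop :=
  exists (q : 'I_s -> {poly F}) (m : 'I_s -> nat),
    [/\ injective q,
        forall j, q j \is monic /\ irreducible_poly (q j),
        forall j, (0 < m j)%N
      & p = \prod_(j < s) q j ^+ m j].

(* The number of distinct irreducible factors does not depend on the generator:
   another generator is c a + u with c != 0 and u in [L, L], and right
   multiplication by u is zero. *)
Definition cyclic_with_factors (F : fieldType) (L : vectType F)
    (br : {bilinear L -> L -> L}) (s : nat) : Prop :=
  exists a : L,
    generates br a /\ has_distinct_irreducible_factors (assoc_poly br a) s.

Definition has_precisely_maximal_subalgebras (F : fieldType) (L : vectType F)
    (br : {bilinear L -> L -> L}) (s : nat) : Prop :=
  exists M : 'I_s -> {vspace L},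
    injective M /\
    forall U : {vspace L}, maximal_subalgebra br U <-> exists i, U = M i.

(* F may be infinite. *)
Definition card_gt (F : fieldType) (s : nat) : Prop :=
  exists f : 'I_s.+1 -> F, injective f.

(* Main.v *)
Require Import Defs.
From mathcomp Require Import all_boot all_order all_algebra.
From Stdlib Require Import Classical_Prop.

Set Implicit Arguments.
Unset Strict Implicit.
Unset Printing Implicit Defensive.

Import GRing.Theory.

(** Let [a] generate [L] and let [T] be right multiplication by [a]. The Leibniz
    identity makes right multiplication by every [a^k] with [k >= 2] vanish, so
    the whole product is encoded in [T]: if [y = c a + T z] then
    [br x y = c *: T x]. Hence a subspace stable under [T] is a subalgebra, and a
    subalgebra is stable under [T] as soon as it is not contained in the image
    [N] of [T]. Since [N] is itself stable, and proper unless [L = 0], the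
    maximal subalgebras are exactly the maximal proper [T]-stable subspaces
    ([maximal_subalgebraP]).

    Through [T], the space [L] is the [F[X]]-module [F[X]/(p)], where [a]
    corresponds to [1] and [p] is the associated polynomial ([assoc_poly_act],
    [poly_act_dvd]). The maximal submodules of [F[X]/(p)] are the [(q)/(p)] with
    [q] an irreducible factor of [p] ([maximal_stableP]), and distinct monic [q]
    give distinct submodules. So a cyclic algebra with [s] distinct factors has
    precisely [s] maximal subalgebras ([cyclic_maximal_count]), over any field.

    Conversely, suppose that there are precisely [s] maximal subalgebras and that
    the field has more than [s] elements. A vector space over such a field is not
    the union of [s] proper subspaces ([not_union_subspaces]), so some [a] lies in
    no maximal subalgebra. By finite dimension every proper subalgebra lies in a
    maximal one, so [a] generates [L] ([finite_maximal_cyclic]). The number of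
    factors of its associated polynomial is then [s], by the count in the cyclic
    case. *)

(** * The action of polynomials through an endomorphism *)

Section PolyAction.
Local Open Scope ring_scope.
Variables (F : fieldType) (L : vectType F) (T : {linear L -> L}).
Implicit Types (f g p q : {poly F}) (v x : L) (S U : {vspace L}).

Let n := \dim {:L}.

Definition stable S : Prop := forall x, x \in S -> T x \in S.

(** [f(T) v]. An explicit sum is used because the endomorphisms of a possibly
    zero space do not form a nontrivial ring in which [f] could be evaluated. *)
Definition poly_act f v : L := \sum_(i < size f) f`_i *: iter i T v.

Definition krylov v k : k.-tuple L :=
  Tuple (introT eqP (size_mkseq (fun i => iter i T v) k)).

(** The [F[X]]-submodule generated by [v]: [\dim L] iterates suffice to span it,
    see [iter_cyc] and [cycP]. *)
Definition cyc v : {vspace L} := <<krylov v n>>%VS.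

Definition maximal_stable U : Prop :=
  (stable U /\ U <> fullv) /\
  forall S, stable S -> S <> fullv -> (U <= S)%VS -> S = U.

Lemma poly_act_widen k f v : (size f <= k)%N ->
  poly_act f v = \sum_(i < k) f`_i *: iter i T v.
Proof.
move=> lefk; rewrite /poly_act (big_ord_widen k (fun i => f`_i *: iter i T v)) //.
rewrite big_mkcond; apply: eq_bigr => i _; case: ltnP => // le_fi.
by rewrite nth_default // scale0r.
Qed.

Lemma poly_actDl f g v : poly_act (f + g) v = poly_act f v + poly_act g v.
Proof.
pose k := maxn (size f) (size g).
rewrite (@poly_act_widen k (f + g)) ?size_polyD //.
rewrite (@poly_act_widen k f) ?leq_maxl // (@poly_act_widen k g) ?leq_maxr //.
by rewrite -big_split; apply: eq_bigr => i _; rewrite coefD scalerDl.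
Qed.

Lemma poly_actZ c f v : poly_act (c *: f) v = c *: poly_act f v.
Proof.
rewrite (@poly_act_widen (size f)) ?size_scale_leq // scaler_sumr.
by apply: eq_bigr => i _; rewrite coefZ scalerA.
Qed.

Lemma poly_act0 v : poly_act 0 v = 0.
Proof. by rewrite /poly_act size_poly0 big_ord0. Qed.

Lemma poly_actN f v : poly_act (- f) v = - poly_act f v.
Proof. by rewrite -scaleN1r poly_actZ scaleN1r. Qed.

Lemma poly_actXn k v : poly_act 'X^k v = iter k T v.
Proof.
rewrite /poly_act size_polyXn big_ord_recr /= coefXn eqxx scale1r big1 ?add0r //.
by move=> i _; rewrite coefXn ltn_eqF ?ltn_ord // scale0r.
Qed.

Lemma poly_actC c v : poly_act c%:P v = c *: v.
Proof. by rewrite -alg_polyC poly_actZ -(expr0 'X) poly_actXn. Qed.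

Lemma poly_act1 v : poly_act 1 v = v.
Proof. by rewrite -(expr0 'X) poly_actXn. Qed.

Lemma poly_actMX f v : poly_act (f * 'X) v = T (poly_act f v).
Proof.
rewrite (@poly_act_widen (size f).+1).
  rewrite big_ord_recl coefMX eqxx scale0r add0r linear_sum.
  by apply: eq_bigr => i _; rewrite coefMX linearZ.
by rewrite (leq_trans (size_polyMleq _ _)) // size_polyX addn2.
Qed.

Lemma poly_actM f g v : poly_act (f * g) v = poly_act f (poly_act g v).
Proof.
elim/poly_ind: f => [|f c IHf]; first by rewrite mul0r !poly_act0.
rewrite mulrDl mulrAC !poly_actDl !poly_actMX IHf poly_actC.
by rewrite mul_polyC poly_actZ.
Qed.

Lemma stable_iter S k v : stable S -> v \in S -> iter k T v \in S.
Proof. by move=> TS vS; elim: k => //= k IHk; apply: TS. Qed.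

Lemma stable_poly_act S f v : stable S -> v \in S -> poly_act f v \in S.
Proof.
by move=> TS vS; apply: memv_suml => i _; apply/memvZ/stable_iter.
Qed.

Lemma poly_actx0 f : poly_act f 0 = 0.
Proof.
apply/eqP; rewrite -memv0; apply: stable_poly_act; last exact: mem0v.
by move=> x; rewrite memv0 => /eqP->; rewrite linear0 mem0v.
Qed.

(** Otherwise the first [n + 1] iterates would be free in a space of dimension
    [n]. The sequence is reversed because [free_cons] peels off the head, which
    has to be the last iterate. *)
Lemma krylov_dep v :
  exists2 k, (k <= n)%N & iter k T v \in <<krylov v k>>%VS.
Proof.
have nfree : ~~ free (rev (krylov v n.+1)).
  apply/negP => /eqP free_n.
  have := dimvS (subvf <<rev (krylov v n.+1)>>%VS).
  by rewrite free_n size_rev size_mkseq ltnn.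
have dep k : (k <= n)%N -> ~~ free (rev (krylov v k.+1)) ->
    exists2 k, (k <= n)%N & iter k T v \in <<krylov v k>>%VS.
  elim: k => [|k IHk] lekn; rewrite /= mkseqS rev_rcons free_cons negb_and negbK.
    by rewrite nil_free orbF => v0; exists 0.
  rewrite (eq_span (mem_rev _)) => /orP[kin|]; first by exists k.+1.
  by apply: IHk; apply: ltnW.
exact: dep nfree.
Qed.

(** If [T^m v] depends on the earlier iterates, these span a stable subspace,
    which therefore contains the whole orbit of [v]. *)
Lemma iter_cyc k v : iter k T v \in cyc v.
Proof.
have [m lemn Tm] := krylov_dep v.
set K := <<_>>%VS in Tm.
have iterK i : (i <= m)%N -> iter i T v \in K.
  rewrite leq_eqVlt => /predU1P[-> //|ltim].
  by apply/memv_span/map_f; rewrite mem_iota.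
have TK : stable K.
  move=> x /coord_span->.
  rewrite linear_sum; apply: memv_suml => i _; rewrite linearZ memvZ //.
  by rewrite nth_mkseq //; apply: (iterK i.+1 (ltn_ord i)).
have leK : (K <= cyc v)%VS.
  apply: sub_span => x /mapP[i]; rewrite mem_iota add0n => ltim ->.
  by apply: map_f; rewrite mem_iota (leq_trans ltim).
exact: (subvP leK) (stable_iter k TK (iterK 0 isT)).
Qed.

Lemma mem_cyc v : v \in cyc v.
Proof. exact: (iter_cyc 0). Qed.

Lemma cycP v x : reflect (exists f, x = poly_act f v) (x \in cyc v).
Proof.
apply: (iffP idP) => [|[f ->]]; last first.
  by apply: memv_suml => i _; apply/memvZ/iter_cyc.
move=> xv.
exists (\sum_i coord (krylov v n) i x *: 'X^i).
rewrite (big_morph (poly_act^~ v) (fun g h => poly_actDl g h v) (poly_act0 v)).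
rewrite {1}(coord_span xv); apply: eq_bigr => i _.
by rewrite poly_actZ poly_actXn nth_mkseq.
Qed.

Lemma stable_cyc v : stable (cyc v).
Proof.
by move=> x /cycP[f ->]; apply/cycP; exists (f * 'X); rewrite poly_actMX.
Qed.

Lemma cyc_sub S v : stable S -> v \in S -> (cyc v <= S)%VS.
Proof. by move=> TS vS; apply/subvP => x /cycP[f ->]; apply: stable_poly_act. Qed.

(** * Maximal submodules of a cyclic module *)

Variables (a : L) (p : {poly F}).
Hypothesis cyc_full : cyc a = fullv.
Hypothesis p_monic : p \is monic.
Hypothesis size_p : size p = n.+1.
Hypothesis p_a : poly_act p a = 0.

(** [L] is [F[X]/(p)]: reduce [f] modulo [p], and use that the first [n] iterates
    of [a] span a space of dimension [n], so are free. *)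
Lemma poly_act_dvd f : (poly_act f a == 0) = (p %| f).
Proof.
apply/eqP/idP => [|/divpK <-]; last by rewrite poly_actM p_a poly_actx0.
rewrite {1}(divp_eq f p) poly_actDl poly_actM p_a poly_actx0 add0r => r_a.
have free_a : free (krylov a n).
  apply: (@basis_free _ _ fullv).
  by rewrite basisEdim -[<<_>>%VS]/(cyc a) cyc_full subvf size_tuple leqnn.
have /freeP fr := free_a.
have le_r : (size (f %% p)%R <= n)%N.
  by rewrite -ltnS -size_p ltn_modp monic_neq0.
apply/eqP/polyP => i; rewrite coef0.
have [lt_in|le_ni] := ltnP i n; last by rewrite nth_default // (leq_trans le_r).
apply: (fr (fun j => (f %% p)`_j) _ (Ordinal lt_in)).
rewrite -[RHS]r_a (poly_act_widen _ le_r).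
by apply: eq_bigr => j _; rewrite nth_mkseq.
Qed.

Variables (s : nat) (q : 'I_s -> {poly F}) (m : 'I_s -> nat).
Hypothesis q_inj : injective q.
Hypothesis q_irr : forall j, q j \is monic /\ irreducible_poly (q j).
Hypothesis m_gt0 : forall j, (0 < m j)%N.
Hypothesis p_fact : p = \prod_(j < s) q j ^+ m j.

(** The submodule [(q j)/(p)] of [F[X]/(p)]. *)
Definition maxsub j := cyc (poly_act (q j) a).

Lemma q_dvd_p j : q j %| p.
Proof.
rewrite p_fact (bigD1 j) //= dvdp_mulr //.
by rewrite -(prednK (m_gt0 j)) exprS dvdp_mulr.
Qed.

Lemma mem_maxsub j f : (poly_act f a \in maxsub j) = (q j %| f).
Proof.
apply/cycP/idP => [[g]|/divpK <-]; last by exists (f %/ q j); rewrite poly_actM.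
rewrite -poly_actM => /eqP; rewrite -subr_eq0 -poly_actN -poly_actDl poly_act_dvd.
move/(dvdp_trans (q_dvd_p j)) => dv.
by rewrite -(subrK (g * q j) f) dvdp_add // dvdp_mull.
Qed.

Lemma irreducible_factor_dvd i j : q j %| q i -> i = j.
Proof.
move=> dvd_ji; apply: q_inj; have [[mi irri] [mj irrj]] := (q_irr i, q_irr j).
have sj : size (q j) != 1 by rewrite neq_ltn irrj orbT.
by apply/esym/eqP; rewrite -eqp_monic //; apply: irri.2.
Qed.

Lemma maxsub_inj : injective maxsub.
Proof.
move=> i j eq_ij; apply: irreducible_factor_dvd.
by rewrite -mem_maxsub -eq_ij mem_maxsub.
Qed.

(** Let [I] be the ideal of the [f] with [f(T) a] in [S]. If [S] lies in no
    [maxsub j], then [I] is comaximal with every [q j], hence with their product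
    [p]; as [p] is in [I] too, [1] is in [I]. *)
Lemma stable_sub_maxsub S :
  stable S -> S <> fullv -> exists j, (S <= maxsub j)%VS.
Proof.
move=> TS nfull.
have [/existsP //|/existsPn nsub] := boolP [exists j, (S <= maxsub j)%VS].
case: nfull.
(* the ideal (g) is comaximal with I *)
pose comax g := exists u w, u * g + w = 1 /\ poly_act w a \in S.
have comax1 : comax 1 by exists 1, 0; rewrite mulr1 addr0 poly_act0 mem0v.
have comaxM f g : comax f -> comax g -> comax (f * g).
  move=> [u [v [uv vS]]] [u' [v' [uv' vS']]].
  exists (u * u'), (u * f * v' + v); split.
    by rewrite addrA mulrACA -mulrDr uv' mulr1.
  by rewrite poly_actDl poly_actM memvD // stable_poly_act.
have comax_q j : comax (q j).
  have /subvPn[x xS] := nsub j.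
  have /cycP[f fx] : x \in cyc a by rewrite cyc_full memvf.
  have [_ irr_qj] := q_irr j.
  move: xS; rewrite fx mem_maxsub -irreducible_poly_coprime //.
  move=> fS /Bezout_eq1_coprimepP[[u v] /= uv].
  by exists u, (v * f); rewrite poly_actM stable_poly_act.
have [u [v [uv vS]]] : comax p.
  rewrite p_fact; apply: big_ind => // j _.
  by elim: (m j) => [|k IHk]; rewrite ?expr0 // exprS; apply: comaxM.
apply/eqP; rewrite eqEsubv subvf -cyc_full cyc_sub //.
by rewrite -(poly_act1 a) -uv poly_actDl poly_actM p_a poly_actx0 add0r.
Qed.

Lemma maxsub_maximal j : maximal_stable (maxsub j).
Proof.
have TM : stable (maxsub j) by apply: stable_cyc.
split=> [|S TS nfull]; last first.
  have [k leSk] := stable_sub_maxsub TS nfull.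
  move=> leMS; apply/eqP; rewrite eqEsubv leMS andbT.
  suff -> : j = k by [].
  apply: irreducible_factor_dvd.
  by rewrite -mem_maxsub (subvP leSk) // (subvP leMS) // mem_maxsub.
split=> // full; have [mj irrj] := q_irr j.
have : q j %| 1 by rewrite -mem_maxsub full memvf.
by rewrite dvdp1 => /eqP sj; move: irrj.1; rewrite sj.
Qed.

Lemma maximal_stableP U : maximal_stable U <-> exists j, U = maxsub j.
Proof.
split=> [[[TU nfull] maxU]|[j ->]]; last exact: maxsub_maximal.
have [j leUj] := stable_sub_maxsub TU nfull.
exists j; have [[TM nM] _] := maxsub_maximal j.
by rewrite (maxU _ TM nM leUj).
Qed.

End PolyAction.

(** * Cyclic Leibniz algebras *)

Section CyclicLeibniz.
Local Open Scope ring_scope.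
Variables (F : fieldType) (L : vectType F) (br : {bilinear L -> L -> L}).
Hypothesis hL : right_leibniz br.
Variable a : L.

Let n := \dim {:L}.
Let T : {linear L -> L} := applyr br a.
Implicit Types (x y z : L) (S U : {vspace L}).

(** In the Leibniz identity for [x, y, a], the bracket with [br y a] is a
    commutator of right multiplications; it vanishes for [y = a], and inductively
    once right multiplication by [y] is zero. *)
Lemma br_iter k x : br x (iter k.+1 T a) = 0.
Proof.
elim: k x => [|k IHk] x; first by rewrite /= hL subrr.
by rewrite iterS [T _]/(br _ a) hL !IHk linear0l subrr.
Qed.

Lemma br_T_cyc x z : z \in cyc T a -> br x (T z) = 0.
Proof.
move=> /cycP[f ->]; rewrite !linear_sum big1 // => i _.
transitivity (f`_i *: br x (iter i.+1 T a)); first by rewrite iterS !linearZ.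
by rewrite br_iter scaler0.
Qed.

Lemma cyc_decomp y : y \in cyc T a ->
  exists c z, z \in cyc T a /\ y = T z + c *: a.
Proof.
case/cycP=> f ->; elim/poly_ind: f => [|f c _].
  by exists 0, 0; rewrite mem0v linear0 scale0r addr0 poly_act0.
exists c, (poly_act T f a); rewrite poly_actDl poly_actMX poly_actC.
by split=> //; apply/cycP; exists f.
Qed.

(** Besides making the span of the powers of [a] a subalgebra, this is why every
    [T]-stable subspace is a subalgebra once that span is all of [L]. *)
Lemma br_cyc x y : y \in cyc T a -> exists c, br x y = c *: T x.
Proof.
case/cyc_decomp=> c [z [zK ->]]; exists c.
by rewrite linearDr br_T_cyc // add0r linearZr_LR.
Qed.

Hypothesis a_gen : generates br a.

Lemma generator_cyc : cyc T a = fullv.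
Proof.
apply: a_gen; last exact: mem_cyc.
move=> x y xK /(br_cyc x)[c ->]; apply/memvZ/stable_cyc/xK.
Qed.

Lemma mem_generated x : x \in cyc T a.
Proof. by rewrite generator_cyc memvf. Qed.

Lemma stable_subalgebra S : stable T S -> subalgebra br S.
Proof.
move=> TS x y xS _.
by have [c ->] := br_cyc x (mem_generated y); apply/memvZ/TS.
Qed.

Lemma T_limg x : T x \in limg (linfun T).
Proof. by rewrite -(lfunE T) memv_img ?memvf. Qed.

(** An element of [S] outside the image of [T] acts on the right as a nonzero
    multiple of [T]. *)
Lemma subalgebra_stable S :
  subalgebra br S -> (S <= limg (linfun T))%VS \/ stable T S.
Proof.
move=> algS; have [|/subvPn[y yS ynN]] := boolP (S <= limg (linfun T))%VS.
  by left.
right=> x xS; have [c [z [zK yE]]] := cyc_decomp (mem_generated y).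
have c0 : c != 0.
  by apply: contraNneq ynN => c0; rewrite yE c0 scale0r addr0 T_limg.
have := algS x y xS yS; rewrite yE linearDr br_T_cyc // add0r linearZr_LR.
by move/(memvZ c^-1); rewrite scalerA mulVf // scale1r.
Qed.

(** Right multiplication by [a = T z] is zero, and it is [T] itself. *)
Lemma generator_notin_image z : T z = a -> a = 0.
Proof.
move=> Tz; have T0 x : T x = 0 by rewrite -(br_T_cyc x (mem_generated z)) Tz.
by rewrite -Tz T0.
Qed.

(** If the image contained [a], then [a = 0], so [L = 0] would have no proper
    subspace [U]. *)
Lemma image_proper U : U <> fullv -> limg (linfun T) <> fullv.
Proof.
move=> nU full; apply: nU; have /memv_imgP[z _] : a \in limg (linfun T).
  by rewrite full memvf.
rewrite lfunE => /esym/generator_notin_image a0.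
apply/eqP; rewrite eqEsubv subvf; apply/subvP => x _.
by have /cycP[f ->] := mem_generated x; rewrite a0 poly_actx0 mem0v.
Qed.

(** The two notions could differ only through subalgebras contained in the image
    [N] of [T] that are not stable. As [N] is stable and proper, a subspace of [N]
    that is maximal in either sense equals [N]. *)
Lemma maximal_subalgebraP U : maximal_subalgebra br U <-> maximal_stable T U.
Proof.
have TN : stable T (limg (linfun T)) by move=> x _; apply: T_limg.
split=> [[[algU nU] maxU]|[[TU nU] maxU]]; have nN := image_proper nU.
  split=> [|S TS nS leUS]; last first.
    by apply: maxU => //; split=> //; apply: stable_subalgebra.
  split=> //; have [leUN|//] := subalgebra_stable algU.
  by rewrite -(maxU _ _ leUN) //; split=> //; apply: stable_subalgebra.
split=> [|S [algS nS] leUS]; first by split=> //; apply: stable_subalgebra.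
have [leSN|TS] := subalgebra_stable algS; last exact: maxU.
have eqN := maxU _ TN nN (subv_trans leUS leSN).
by apply/eqP; rewrite eqEsubv leUS andbT -eqN.
Qed.

Lemma lpow_tuple_krylov : lpow_tuple br a = krylov T a n.
Proof.
apply: eq_from_tnth => i; rewrite tnth_mktuple (tnth_nth 0) nth_mkseq //.
Qed.

Lemma assoc_poly_lead :
  assoc_poly br a \is monic /\ size (assoc_poly br a) = n.+1.
Proof.
rewrite /assoc_poly -/n; set r := \sum_(i < n | _) _.
have le_r : (size (- r)%R < size ('X^n : {poly F}))%N.
  rewrite size_polyN size_polyXn ltnS; apply: (leq_trans (size_sum _ _ _)).
  apply/bigmax_leqP => i _; apply: (leq_trans (size_scale_leq _ _)).
  by rewrite size_polyXn.
by rewrite monicE lead_coefDl // lead_coefXn size_polyDl // size_polyXn.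
Qed.

(** The expansion of [T^n a] in the basis differs from the one used in the
    associated polynomial by the term [c_0 a] only. If [c_0] were nonzero, [a]
    would be in the image of [T], hence zero; so [c_0 a = 0] in all cases. *)
Lemma assoc_poly_act : poly_act T (assoc_poly br a) a = 0.
Proof.
have coordK x : x = \sum_i coord (krylov T a n) i x *: iter i T a.
  have /coord_span {1}-> : x \in <<krylov T a n>>%VS by exact: mem_generated.
  by apply: eq_bigr => i _; rewrite nth_mkseq.
(* for n = 0 the polynomial is 1 and a = 0 *)
have [n0|n_gt0] := posnP n.
  by rewrite [LHS]coordK big1 // => -[i]; rewrite n0.
have Tn : br (lpow br a n) a = iter n T a.
  by rewrite /lpow -[in RHS](prednK n_gt0).
rewrite /assoc_poly -/n lpow_tuple_krylov Tn poly_actDl poly_actN poly_actXn.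
rewrite (big_morph (poly_act T ^~ a) (fun g h => poly_actDl T g h a)
  (poly_act0 T a)).
pose c i := coord (krylov T a n) i (iter n T a); pose i0 := Ordinal n_gt0.
have split_Tn :
    iter n T a = c i0 *: a + \sum_(i < n | (0 < i)%N) c i *: iter i T a.
  rewrite {1}[iter n T a]coordK (bigD1 i0) //=; congr (_ + _).
  by apply: eq_bigl => i; rewrite -val_eqE lt0n.
have T_iter k : (0 < k)%N -> iter k T a \in limg (linfun T).
  by move=> k_gt0; rewrite -(prednK k_gt0) T_limg.
have c0a : c i0 *: a = 0.
  have [->|c0] := eqVneq (c i0) 0; first exact: scale0r.
  suff /memv_imgP[z _] : a \in limg (linfun T).
    by rewrite lfunE => /esym/generator_notin_image->; rewrite scaler0.
  rewrite -[a]scale1r -(mulVf c0) -scalerA memvZ //.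
  have -> : c i0 *: a = iter n T a - \sum_(i < n | (0 < i)%N) c i *: iter i T a.
    by rewrite split_Tn addrK.
  by rewrite memvB ?T_iter // memv_suml // => i i_gt0; rewrite memvZ ?T_iter.
apply/eqP; rewrite subr_eq0 {1}split_Tn c0a add0r; apply/eqP/eq_bigr => i _.
by rewrite poly_actZ poly_actXn.
Qed.

End CyclicLeibniz.

(** * Factorization into irreducible polynomials *)

Section PolyFactorization.
Local Open Scope ring_scope.
Variable F : fieldType.
Implicit Types (p q : {poly F}) (r : seq {poly F}).

Lemma monic_size1 p : p \is monic -> (size p <= 1)%N -> p = 1.
Proof.
by move=> + /size1_polyC pE; rewrite pE monicE lead_coefC => /eqP->.
Qed.

(** Excluded middle enters here because irreducibility is not decidable over an
    arbitrary field. *)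
Lemma monic_factorization p : p \is monic -> exists2 r,
  (forall q, q \in r -> q \is monic /\ irreducible_poly q) & p = \prod_(q <- r) q.
Proof.
have [k] := ubnP (size p); elim: k p => // k IHk p; rewrite ltnS => le_pk mon_p.
have [sp1|sp1] := leqP (size p) 1.
  by exists [::] => //; rewrite big_nil; apply: monic_size1.
have [irr_p|red_p] := classic (irreducible_poly p).
  by exists [:: p]; [move=> q; rewrite inE => /eqP-> | rewrite big_seq1].
have [d [mon_d sd dvd_p nd]] : exists d,
    [/\ d \is monic, (size d != 1)%N, d %| p & ~~ (d %= p)].
  apply: NNPP => no_d; apply: red_p; split=> // d sd dvd_p.
  have d0 : d != 0 by apply: contraTneq dvd_p => ->; rewrite dvd0p monic_neq0.
  have lc : (lead_coef d)^-1 != 0 by rewrite invr_eq0 lead_coef_eq0.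
  apply: contraT => nd; case: no_d; exists ((lead_coef d)^-1 *: d); split.
  - by rewrite monicE lead_coefZ mulVf // lead_coef_eq0.
  - by rewrite size_scale.
  - by rewrite dvdpZl.
  - by rewrite (eqp_ltrans (eqp_scale _ lc)).
have [e pE] : exists e, e * d = p by exists (p %/ d); apply: divpK.
have mon_e : e \is monic by rewrite -(monicMr _ mon_d) pE.
have sd1 : (1 < size d)%N.
  by rewrite ltn_neqAle eq_sym sd size_poly_gt0 monic_neq0.
have se1 : (1 < size e)%N.
  rewrite ltnNge; apply: contra nd => se.
  by rewrite -pE (monic_size1 mon_e se) mul1r eqpxx.
have sp : size p = (size e + size d).-1 by rewrite -pE size_mul ?monic_neq0.
have [|r1 irr1 eE] := IHk e _ mon_e.
  apply: leq_trans le_pk; rewrite sp -(prednK (ltnW sd1)) addnS -addn1.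
  by rewrite leq_add2l -ltnS prednK // ltnW.
have [|r2 irr2 dE] := IHk d _ mon_d.
  apply: leq_trans le_pk; rewrite sp -(prednK (ltnW se1)) addSn -add1n.
  by rewrite leq_add2r -ltnS prednK // ltnW.
exists (r1 ++ r2); last by rewrite big_cat /= -eE -dE pE.
by move=> q; rewrite mem_cat => /orP[/irr1|/irr2].
Qed.

Lemma monic_has_factors p :
  p \is monic -> exists s, has_distinct_irreducible_factors p s.
Proof.
case/monic_factorization=> r irr_r ->.
exists (size (undup r)), (fun j => (undup r)`_j).
exists (fun j => count_mem (undup r)`_j r).
have mem_r (j : 'I_(size (undup r))) : (undup r)`_j \in r.
  by rewrite -mem_undup mem_nth.
split=> [i j /eqP|j|j|].
- by rewrite nth_uniq ?undup_uniq // => /eqP/val_inj.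
- exact: irr_r.
- by rewrite -has_count has_pred1.
rewrite -(prodr_undup_exp_count r xpredT id) /= (big_nth 0) big_mkord.
by [].
Qed.

End PolyFactorization.

(** * Unions of proper subspaces *)

Section SubspaceUnion.
Local Open Scope ring_scope.
Variables (F : fieldType) (L : vectType F).

(** By induction on the family: let [x] avoid the subspaces other than [M], and
    suppose [x] is in [M]. For [y] outside [M], no point of the line [y + c x] is
    in [M], and each other subspace contains at most one of its points; so with
    more scalars than subspaces some point avoids them all. *)
Lemma not_union_subspaces (cs : seq F) (Ms : seq {vspace L}) :
  uniq cs -> (size Ms < size cs)%N -> (forall M, M \in Ms -> M <> fullv) ->
  exists x : L, forall M, M \in Ms -> x \notin M.
Proof.
move=> uniq_cs; elim: Ms => [|M Ms IHMs] /= lt_s proper; first by exists 0.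
have [M' M'Ms|x xMs] := IHMs (ltnW lt_s).
  by apply: proper; rewrite inE M'Ms orbT.
have [xM|xM] := boolP (x \in M); last first.
  by exists x => M'; rewrite inE => /predU1P[->|/xMs].
have /subvPn[y _ yM] : ~~ (fullv <= M)%VS.
  apply/negP => leM; apply: (proper M); first by rewrite inE eqxx.
  by apply/eqP; rewrite eqEsubv subvf.
have [/hasP[c c_cs /allP outc]|/hasPn inc] :=
    boolP (has (fun c => all (fun M' : {vspace L} => y + c *: x \notin M') Ms) cs).
  exists (y + c *: x) => M'; rewrite inE => /predU1P[->|/outc//].
  by rewrite rpredDr ?memvZ.
(* if every point were covered, sending c to a subspace containing y + c x
   would be injective *)
pose idx c := find (fun M' : {vspace L} => y + c *: x \in M') Ms.
have has_c c : c \in cs -> has (fun M' : {vspace L} => y + c *: x \in M') Ms.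
  move/inc/allPn => [M' M'Ms]; rewrite negbK => ?; apply/hasP; by exists M'.
have idx_inj : {in cs &, injective idx}.
  move=> c d c_cs d_cs eq_cd; apply/eqP; rewrite -subr_eq0; apply: contraT => ncd.
  have := nth_find fullv (has_c c c_cs); have := nth_find fullv (has_c d d_cs).
  rewrite -/(idx c) -/(idx d) eq_cd => dM cM.
  have /xMs/negP[] : nth fullv Ms (idx d) \in Ms.
    by rewrite mem_nth // -has_find has_c.
  have := memvB cM dM; rewrite opprD addrACA subrr add0r -scalerBl.
  by move/(memvZ (c - d)^-1); rewrite scalerA mulVf // scale1r.
have := @uniq_leq_size _ (map idx cs) (iota 0 (size Ms)).
rewrite map_inj_in_uniq // uniq_cs size_map size_iota => /(_ isT).
suff sub : {subset map idx cs <= iota 0 (size Ms)}.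
  by move=> /(_ sub); rewrite leqNgt (ltnW lt_s).
by move=> _ /mapP[c c_cs ->]; rewrite mem_iota /= -has_find has_c.
Qed.

End SubspaceUnion.

(** * Counting maximal subalgebras *)

Section MaximalSubalgebras.
Local Open Scope ring_scope.
Variables (F : fieldType) (L : vectType F) (br : {bilinear L -> L -> L}).

Lemma proper_sub_maximal (S : {vspace L}) : proper_subalgebra br S ->
  exists2 M, maximal_subalgebra br M & (S <= M)%VS.
Proof.
have [k] := ubnP (\dim {:L} - \dim S)%N.
elim: k S => // k IHk S; rewrite ltnS => le_k propS.
have [maxS|nmax] := classic (maximal_subalgebra br S); first by exists S.
have [S' [propS' leSS' neS]] : exists S',
    [/\ proper_subalgebra br S', (S <= S')%VS & S' <> S].
  apply: NNPP => no; apply: nmax; split=> // S' propS' leSS'.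
  by apply: NNPP => neS; apply: no; exists S'.
have ltSS' : (\dim S < \dim S')%N.
  rewrite ltnNge; apply/negP => le_dim; apply: neS; apply/eqP.
  by rewrite eq_sym eqEdim leSS'.
have [|M maxM leM] := IHk S' _ propS'; last first.
  by exists M => //; apply: subv_trans leM.
apply: leq_trans le_k; apply: ltn_sub2l => //.
by apply: leq_trans ltSS' _; apply/dimvS/subvf.
Qed.

Lemma cyclic_maximal_count (hL : right_leibniz br) a s :
  generates br a -> has_distinct_irreducible_factors (assoc_poly br a) s ->
  has_precisely_maximal_subalgebras br s.
Proof.
move=> a_gen [q [m [q_inj q_irr m_gt0 p_fact]]].
have [p_mon size_p] := assoc_poly_lead br a.
have p_a := assoc_poly_act hL a_gen; have full := generator_cyc hL a_gen.
exists (maxsub (applyr br a) a q); split.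
  exact: (maxsub_inj full p_mon size_p p_a q_inj q_irr m_gt0 p_fact).
move=> U; rewrite (maximal_subalgebraP hL a_gen).
exact: (maximal_stableP full p_mon size_p p_a q_inj q_irr m_gt0 p_fact).
Qed.

Lemma precisely_maximal_inj s t :
  has_precisely_maximal_subalgebras br s ->
  has_precisely_maximal_subalgebras br t -> s = t.
Proof.
move=> [M [M_inj MP]] [N [N_inj NP]].
rewrite -(card_ord s) -(card_ord t) -(size_codom M) -(size_codom N).
apply/perm_size/uniq_perm => [||U].
- by rewrite map_inj_uniq ?enum_uniq.
- by rewrite map_inj_uniq ?enum_uniq.
apply/codomP/codomP => [[i Ui]|[i Ui]].
  by apply/NP/MP; exists i.
by apply/MP/NP; exists i.
Qed.

Lemma finite_maximal_cyclic s : card_gt F s ->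
  has_precisely_maximal_subalgebras br s -> exists a, generates br a.
Proof.
move=> [c c_inj] [M [M_inj MP]].
have [|||a aM] := @not_union_subspaces F L (codom c) (codom M).
- by rewrite map_inj_uniq ?enum_uniq.
- by rewrite !size_codom !card_ord.
- move=> _ /codomP[i ->].
  by have [[_ nM] _] : maximal_subalgebra br (M i) by apply/MP; exists i.
exists a => S algS aS; apply: NNPP => nS.
have [U /MP[i ->] leS] := proper_sub_maximal (conj algS nS).
by have /negP[] := aM (M i) (codom_f _ _); apply: (subvP leS).
Qed.

End MaximalSubalgebras.

Theorem theorem2p2 (s : nat) (hs : (1 <= s)%N) (F : fieldType)
    (L : vectType F) (br : {bilinear L -> L -> L}%R)
    (hL : right_leibniz br) (hF : card_gt F s) :
  has_precisely_maximal_subalgebras br s <-> cyclic_with_factors br s.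
Proof.
split=> [maxs|[a [a_gen p_fact]]]; last exact: cyclic_maximal_count p_fact.
have [a a_gen] := finite_maximal_cyclic hF maxs.
have [p_mon _] := assoc_poly_lead br a.
have [t p_fact] := monic_has_factors p_mon.
exists a; split=> //.
by rewrite (precisely_maximal_inj maxs (cyclic_maximal_count hL a_gen p_fact)).
Qed.
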